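(* Each of the following real polynomial systems has an isochronous center at the origin $O$, with the indicated Urabe function $h$: (i) $\dot x=-y+xy-\frac12x^{2}y+\frac18x^{3}y$, $\dot y=x-\frac34x^{2}+\frac14y^{2}+\frac{5}{24}x^{3}+\frac38xy^{2}-\frac1{16}x^{2}y^{2}-\frac1{48}x^{4}$, with $h(\xi)=\dfrac{3\xi}{\sqrt{16+9\xi^{2}}}$; (ii) $\dot x=-y+xy+9x^{2}y+6x^{3}y$, $\dot y=x+\frac32x^{2}-\frac12y^{2}+x^{3}+12xy^{2}+12x^{2}y^{2}+\frac12x^{4}$, with $h(\xi)=-\dfrac{\xi}{\sqrt{4+49\xi^{2}}}$; (iii) for every $a_{3,1}\in\mathbb R$: $\dot x=-y+xy-\left(3a_{3,1}+\frac29\right)x^{2}y+a_{3,1}x^{3}y$, $\dot y=x+\left(\frac19-3a_{3,1}\right)xy^{2}$, with $h(\xi)=\dfrac{\xi}{\sqrt{(1-27a_{3,1})\xi^{2}+9}}$; (iv) $\dot x=-y+xy$, $\dot y=x-\frac32x^{2}+y^{2}+x^{3}-\frac14x^{4}$, with $h(\xi)=\dfrac{\xi}{\sqrt{1+\xi^{2}}}$.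
   Context: For a real planar polynomial system $\dot x=-y+A(x,y)$, $\dot y=x+B(x,y)$, with $A,B$ polynomials having no terms of degree $<2$, the origin $O$ is a center if there is a punctured neighborhood of $O$ in which every orbit is a closed orbit surrounding $O$; it is an isochronous center if moreover all these closed orbits have the same period. Urabe function: consider a system $\dot x=p_0(x)+p_1(x)y$, $\dot y=q_0(x)+q_1(x)y+q_2(x)y^2$ with $p_i,q_i$ real polynomials, $p_0(0)=q_0(0)=0$, $p_1(0)\neq0$, and such that $-\frac{p_1'p_0}{p_1}+q_1+p_0'-\frac{2q_2p_0}{p_1}\equiv0$ (this holds automatically when $p_0\equiv q_1\equiv0$). Put $f=-\frac{q_2+p_1'}{p_1}$, $g=-\frac{q_2p_0^2}{p_1}+q_1p_0-p_1q_0$; the change of variables $z=p_0(x)+p_1(x)y$ transforms the system into $\dot x=z$, $\dot z=-g(x)-f(x)z^2$. Let $F(x)=\int_0^xf(s)\,ds$ and let $\xi$ be defined near $0$ by $\frac12\xi(x)^2=\int_0^xg(s)e^{2F(s)}ds$ with $x\xi(x)>0$ for $x\ne0$. When $O$ is an isochronous center, its Urabe function is the odd real-analytic function $h$ defined near $0$ satisfying $\dfrac{\xi(x)}{1+h(\xi(x))}=g(x)e^{F(x)}$ for $x$ near $0$. Here all systems have $p_0\equiv q_1\equiv0$. *)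

(* Defs.v *)
From Stdlib Require Import Reals Lra.
Open Scope R_scope.

Definition is_solution (P Q : R -> R -> R) (x y : R -> R) : Prop :=
  forall t, derivable_pt_lim x t (P (x t) (y t)) /\
            derivable_pt_lim y t (Q (x t) (y t)).

(** The orbit through (p1,p2) is a closed orbit of minimal period T > 0
    that does not pass through O and surrounds O (nonzero winding number
    about O, expressed through a continuous polar angle). *)
Definition closed_orbit_surrounding_O (P Q : R -> R -> R) (p1 p2 T : R) : Prop :=
  exists x y theta : R -> R,
    is_solution P Q x y /\ x 0 = p1 /\ y 0 = p2 /\
    0 < T /\
    (forall t, x (t + T) = x t /\ y (t + T) = y t) /\
    (forall s, 0 < s < T -> ~ (x s = p1 /\ y s = p2)) /\
    (forall t, ~ (x t = 0 /\ y t = 0)) /\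
    continuity theta /\
    (forall t, x t = sqrt (x t ^ 2 + y t ^ 2) * cos (theta t) /\
               y t = sqrt (x t ^ 2 + y t ^ 2) * sin (theta t)) /\
    theta T <> theta 0.

Definition is_center (P Q : R -> R -> R) : Prop :=
  exists delta, 0 < delta /\
    forall p1 p2, 0 < p1 ^ 2 + p2 ^ 2 < delta ^ 2 ->
      exists T, closed_orbit_surrounding_O P Q p1 p2 T.

Definition is_isochronous_center (P Q : R -> R -> R) : Prop :=
  exists delta T, 0 < delta /\
    forall p1 p2, 0 < p1 ^ 2 + p2 ^ 2 < delta ^ 2 ->
      closed_orbit_surrounding_O P Q p1 p2 T.

(** The Urabe relation for  x' = z, z' = -g(x) - f(x) z^2 :
    F(x) = int_0^x f, (1/2) xi(x)^2 = int_0^x g e^{2F}, x xi(x) > 0,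
    and xi(x) / (1 + h(xi(x))) = g(x) e^{F(x)} for x near 0.
    The integrals are expressed via the antiderivatives F, G vanishing at 0. *)
Definition urabe_relation (f g h : R -> R) : Prop :=
  exists eps (F G : R -> R), 0 < eps /\ F 0 = 0 /\ G 0 = 0 /\
    (forall s, Rabs s < eps ->
        derivable_pt_lim F s (f s) /\
        derivable_pt_lim G s (g s * exp (2 * F s))) /\
    (forall x xi, 0 < Rabs x < eps -> xi ^ 2 / 2 = G x -> 0 < x * xi ->
        xi / (1 + h xi) = g x * exp (F x)).

Definition odd_near_0 (h : R -> R) : Prop :=
  exists r, 0 < r /\ forall u, Rabs u < r -> h (- u) = - h u.

Definition analytic_near_0 (h : R -> R) : Prop :=
  exists r (a : nat -> R), 0 < r /\ forall u, Rabs u < r -> Pser a u (h u).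

Definition is_urabe_function (P Q : R -> R -> R) (h : R -> R) : Prop :=
  exists p1 q0 q2 dp1 : R -> R,
    (forall x y, P x y = p1 x * y) /\
    (forall x y, Q x y = q0 x + q2 x * y ^ 2) /\
    p1 0 <> 0 /\ q0 0 = 0 /\
    (forall s, derivable_pt_lim p1 s (dp1 s)) /\
    odd_near_0 h /\ analytic_near_0 h /\
    urabe_relation (fun s => - (q2 s + dp1 s) / p1 s)
                   (fun s => - (p1 s * q0 s)) h.

Definition P1 (x y : R) : R := - y + x * y - 1/2 * x^2 * y + 1/8 * x^3 * y.
Definition Q1 (x y : R) : R :=
  x - 3/4 * x^2 + 1/4 * y^2 + 5/24 * x^3 + 3/8 * x * y^2
  - 1/16 * x^2 * y^2 - 1/48 * x^4.
Definition h1 (u : R) : R := 3 * u / sqrt (16 + 9 * u^2).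

Definition P2 (x y : R) : R := - y + x * y + 9 * x^2 * y + 6 * x^3 * y.
Definition Q2 (x y : R) : R :=
  x + 3/2 * x^2 - 1/2 * y^2 + x^3 + 12 * x * y^2 + 12 * x^2 * y^2 + 1/2 * x^4.
Definition h2 (u : R) : R := - u / sqrt (4 + 49 * u^2).

Definition P3 (a x y : R) : R := - y + x * y - (3 * a + 2/9) * x^2 * y + a * x^3 * y.
Definition Q3 (a x y : R) : R := x + (1/9 - 3 * a) * x * y^2.
Definition h3 (a u : R) : R := u / sqrt ((1 - 27 * a) * u^2 + 9).

Definition P4 (x y : R) : R := - y + x * y.
Definition Q4 (x y : R) : R := x - 3/2 * x^2 + y^2 + x^3 - 1/4 * x^4.
Definition h4 (u : R) : R := u / sqrt (1 + u^2).

(* Main.v *)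
(** Let [X] be the inverse of [xi] and let [Y u = e^(-F) / p1] at [x = X u].  The Urabe
    relation turns into [X' = (1 + h) p1(X) Y], [Y' = (1 + h) q2(X) Y^2] and
    [- u Y = (1 + h) q0(X)].  Under these three identities, [x = X u], [y = v Y u]
    transforms the system into [u' = v / (1 + h u)], [v' = - u / (1 + h u)]: the orbits
    are the circles [u = r sin phi], [v = r cos phi], and the time spent on such a circle is
    the integral of [1 + h (r sin phi)], which is [2 PI] because [h] is odd.
    For each of the four systems [h] is [c u / S] with [S = sqrt (A + B u^2)], and [X], [Y]
    are explicit:
    (i) [X = 2 (1 - s^2)], [Y = - s^3 / (1 - s^2 + s^4)] with [s = ((3 u + S) / 4)^(-1/3)];
    (ii) [X = (sqrt ((S + 7 u) / (S - u)) - 1) / 2], [Y = - 2 / (S - u)];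
    (iii) [X = 3 u / (S + u)], [Y = - 3 / S];
    (iv) [X = 1 - 1 / (u + S)], [Y = - 1 / (u + S)]. *)

Require Import Defs.
From Stdlib Require Import Reals Lra Lia Ranalysis5.
From Coquelicot Require Import Coquelicot.
Open Scope R_scope.

(** * The power series of [1 / sqrt (1 + t)] *)

(** These are the binomial coefficients of exponent [-1/2], encoded by the ratio of consecutive
    ones. *)
Fixpoint inv_sqrt_coef (n : nat) : R :=
  match n with
  | O => 1
  | S k => - ((2 * INR k + 1) / (2 * INR k + 2)) * inv_sqrt_coef k
  end.

Lemma inv_sqrt_coef_bound n : Rabs (inv_sqrt_coef n) <= 1.
Proof.
  induction n as [|n IH]; simpl; [rewrite Rabs_R1; lra|].
  rewrite Rabs_mult, Rabs_Ropp.
  assert (Hn := pos_INR n).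
  assert (0 <= (2 * INR n + 1) / (2 * INR n + 2)) by (apply Rdiv_le_0_compat; lra).
  assert ((2 * INR n + 1) / (2 * INR n + 2) <= 1) by (apply Rle_div_l; lra).
  rewrite (Rabs_pos_eq _ H).
  assert (Hp := Rabs_pos (inv_sqrt_coef n)).
  nra.
Qed.

Lemma inv_sqrt_radius t : Rabs t < 1 -> Rbar_lt (Rabs t) (CV_radius inv_sqrt_coef).
Proof.
  intros Ht; apply Rbar_lt_le_trans with 1; [exact Ht|].
  apply (proj1 (CV_radius_bounded inv_sqrt_coef)).
  exists 1; intros n; rewrite pow1, Rmult_1_r; apply inv_sqrt_coef_bound.
Qed.

(** Compared coefficient by coefficient, this is [(n + 1) c_(n+1) + n c_n = - c_n / 2], which is the
    defining recurrence. *)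
Lemma inv_sqrt_ode t : Rabs t < 1 ->
  (1 + t) * PSeries (PS_derive inv_sqrt_coef) t = - / 2 * PSeries inv_sqrt_coef t.
Proof.
  intros Ht; apply inv_sqrt_radius in Ht.
  assert (Hd := ex_pseries_derive _ _ Ht).
  rewrite <- (PSeries_scal (- / 2)), Rmult_plus_distr_r, Rmult_1_l, <- PSeries_incr_1.
  rewrite <- PSeries_plus; [|exact Hd|apply ex_pseries_incr_1, Hd].
  apply PSeries_ext; intros [|n];
    unfold PS_plus, PS_scal, PS_incr_1, PS_derive;
    change plus with Rplus; change scal with Rmult.
  - simpl; change zero with 0; field.
  - cbn [inv_sqrt_coef]; rewrite !S_INR; assert (Hn := pos_INR n); field; lra.
Qed.

(** The hypothesis is restricted to the interval between [-|a|] and [|a|] so that it also applies to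
    power series, whose derivative is known only inside the disc of convergence. *)
Lemma constant_of_null_derivative (f : R -> R) a :
  (forall x, Rabs x <= Rabs a -> derivable_pt_lim f x 0) -> f a = f 0.
Proof.
  intros H.
  destruct (Rtotal_order a 0) as [Ha|[->|Ha]]; [|reflexivity|].
  - destruct (MVT_cor2 f (fun _ => 0) a 0 Ha) as [c [Hc _]]; [|lra].
    intros c Hc; apply H; rewrite !Rabs_left1; lra.
  - destruct (MVT_cor2 f (fun _ => 0) 0 a Ha) as [c [Hc _]]; [|lra].
    intros c Hc; apply H; rewrite !Rabs_pos_eq; lra.
Qed.

(** By the differential equation the product of the series with [sqrt (1 + t)] has zero derivative,
    and this product is [1] at [0]. *)
Lemma inv_sqrt_series t : Rabs t < 1 ->
  PSeries inv_sqrt_coef t = / sqrt (1 + t).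
Proof.
  intros Ht.
  assert (Hc : PSeries inv_sqrt_coef t * sqrt (1 + t) =
               PSeries inv_sqrt_coef 0 * sqrt (1 + 0)).
  { apply (constant_of_null_derivative
             (fun t => PSeries inv_sqrt_coef t * sqrt (1 + t))).
    intros x Hx; apply is_derive_Reals.
    assert (Hx1 : Rabs x < 1) by lra.
    assert (Hp : 0 < 1 + x) by (apply Rabs_def2 in Hx1; lra).
    assert (Hs : is_derive (fun t => sqrt (1 + t)) x (/ (2 * sqrt (1 + x)))).
    { auto_derive; [lra|ring]. }
    assert (Hq := sqrt_lt_R0 _ Hp).
    replace 0 with (PSeries (PS_derive inv_sqrt_coef) x * sqrt (1 + x) +
                    PSeries inv_sqrt_coef x * / (2 * sqrt (1 + x))).
    - apply (is_derive_mult (PSeries inv_sqrt_coef) (fun t => sqrt (1 + t)));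
        [apply is_derive_PSeries, inv_sqrt_radius, Hx1|exact Hs|
         intros; apply Rmult_comm].
    - assert (Ho := inv_sqrt_ode x Hx1).
      apply Rmult_eq_reg_r with (sqrt (1 + x)); [|lra].
      rewrite Rmult_0_l, Rmult_plus_distr_r, Rmult_assoc, sqrt_sqrt by lra.
      rewrite (Rmult_comm _ (1 + x)), Ho; field; lra. }
  rewrite PSeries_0, Rplus_0_r, sqrt_1 in Hc; simpl in Hc.
  assert (0 < sqrt (1 + t)) by (apply sqrt_lt_R0; apply Rabs_def2 in Ht; lra).
  apply Rmult_eq_reg_r with (sqrt (1 + t)); [|lra].
  rewrite Hc; field; lra.
Qed.

(** Taking [sqrt A] out of the root leaves [u] times the binomial series at [k u^2], so only odd
    powers of [u] occur. *)
Lemma analytic_linear_div_sqrt (c A B : R) : 0 < A ->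
  analytic_near_0 (fun u => c * u / sqrt (A + B * u ^ 2)).
Proof.
  intros HA.
  set (k := B / A).
  assert (Hk := Rabs_pos k).
  set (a := fun n => if Nat.even n then 0
                     else c / sqrt A * (k ^ Nat.div2 n * inv_sqrt_coef (Nat.div2 n))).
  (* This radius gives both [|u| < 1] and [|k| |u| < 1], hence [|k u^2| < 1]. *)
  exists (/ (1 + Rabs k)), a; split; [apply Rinv_0_lt_compat; lra|].
  intros u Hu; apply is_series_Reals, is_pseries_R.
  assert (Hku : Rabs (k * u ^ 2) < 1).
  { rewrite Rabs_mult, <- RPow_abs.
    assert (Hu0 := Rabs_pos u).
    assert (Rabs u * (1 + Rabs k) < 1).
    { apply Rlt_div_r; [lra|]; unfold Rdiv; rewrite Rmult_1_l; exact Hu. }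
    assert (Rabs k * Rabs u < 1) by nra.
    assert (Rabs u < 1) by nra.
    nra. }
  assert (HAs := sqrt_lt_R0 _ HA).
  (* The summand [0] is the even part of the series; the other one is [u] times a series in
     [u^2]. *)
  replace (c * u / sqrt (A + B * u ^ 2))
    with (0 + u * (c / sqrt A * / sqrt (1 + k * u ^ 2))).
  2:{ assert (0 < 1 + k * u ^ 2) by (apply Rabs_def2 in Hku; lra).
      replace (A + B * u ^ 2) with (A * (1 + k * u ^ 2)) by (unfold k; field; lra).
      rewrite sqrt_mult by lra.
      assert (0 < sqrt (1 + k * u ^ 2)) by (apply sqrt_lt_R0; lra).
      field; lra. }
  apply is_pseries_odd_even.
  - apply is_pseries_R, is_series_ext with (fun n : nat => 0).
    + intros n; unfold a; rewrite Nat.even_mul; simpl; ring.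
    + apply filterlim_ext with (fun _ : nat => 0);
        [|apply filterlim_const].
      intros n; rewrite sum_n_const; simpl; ring.
  - rewrite <- inv_sqrt_series by exact Hku.
    apply is_pseries_R, is_series_ext with
      (fun n => (c / sqrt A) * (inv_sqrt_coef n * (k * u ^ 2) ^ n)).
    + intros n; unfold a.
      replace (2 * n + 1)%nat with (S (2 * n)) by lia.
      rewrite Nat.even_succ, <- Nat.negb_even, Nat.even_mul.
      rewrite Nat.div2_succ_double, Rpow_mult_distr; simpl; ring.
    + apply (is_series_scal (V := R_NormedModule) (c / sqrt A)).
      apply is_pseries_R, PSeries_correct, CV_radius_inside, inv_sqrt_radius, Hku.
Qed.

(** * Inverse functions and polar angles *)

Lemma increasing_of_pos_derivative (f df : R -> R) lb ub :
  (forall x, lb <= x <= ub -> derivable_pt_lim f x (df x) /\ 0 < df x) ->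
  forall x y, lb <= x -> x < y -> y <= ub -> f x < f y.
Proof.
  intros H x y Hx Hxy Hy.
  destruct (MVT_cor2 f df x y Hxy) as [c [Hc Hc']]; [intros; apply H; lra|].
  assert (0 < df c) by (apply H; lra).
  nra.
Qed.

Lemma derivable_pt_lim_continuity_pt f x l : derivable_pt_lim f x l -> continuity_pt f x.
Proof. intros H; apply derivable_continuous_pt; exists l; exact H. Qed.

(** A positive derivative makes [f] strictly increasing, so the right inverse [g] is also a left
    inverse on [[lb, ub]]. This gives continuity of [g] at [y], and then the rule for the derivative
    of an inverse applies. *)
Lemma inverse_derivable (f df g : R -> R) lb ub y :
  lb < ub ->
  (forall x, lb <= x <= ub -> derivable_pt_lim f x (df x) /\ 0 < df x) ->
  (forall z, f lb <= z <= f ub -> lb <= g z <= ub /\ f (g z) = z) ->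
  f lb < y < f ub ->
  derivable_pt_lim g y (/ df (g y)).
Proof.
  intros Hlu Hf Hg Hy.
  assert (Hinc := increasing_of_pos_derivative f df lb ub Hf).
  assert (Hend : forall x, lb <= x <= ub -> g (f x) = x).
  { intros x Hx.
    assert (Hfx : f lb <= f x <= f ub).
    { split; [destruct (Req_dec lb x) as [->|]|destruct (Req_dec x ub) as [->|]];
        try lra; apply Rlt_le, Hinc; lra. }
    destruct (Hg _ Hfx) as [Hgx He].
    destruct (Rtotal_order (g (f x)) x) as [Hl|[Hl|Hl]]; [|exact Hl|];
      apply Hinc in Hl; lra. }
  assert (Hc : continuity_pt g y).
  { apply (continuity_pt_recip_interv f g lb ub); try assumption.
    - intros x H1 H2; apply Hg; split; assumption.
    - intros x H1 H2; apply Hg; split; assumption.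
    - intros a Ha; eapply derivable_pt_lim_continuity_pt, Hf, Ha. }
  assert (Prf : forall a, g (f lb) <= a <= g (f ub) -> derivable_pt f a).
  { intros a Ha; rewrite !Hend in Ha by lra; exists (df a); apply Hf, Ha. }
  assert (Hgy : g (f lb) <= g y <= g (f ub)).
  { rewrite !Hend by lra; apply Hg; lra. }
  assert (Hd : derive_pt f (g y) (Prf (g y) Hgy) = df (g y)).
  { apply derive_pt_eq_0, Hf, Hg; lra. }
  assert (Hpos : 0 < df (g y)) by (apply Hf, Hg; lra).
  assert (H := derivable_pt_lim_recip_interv f g (f lb) (f ub) y Prf Hc).
  rewrite <- (Rmult_1_l (/ _)), <- Hd.
  apply H; [lra|exact Hy| |rewrite Hd; lra].
  intros z Hz; apply Hg, Hz.
Qed.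

(** Rotating by [- alpha] brings the point into the right half-plane, where its angle is an [atan].
    The resulting formula depends continuously on the point and on [alpha], which is how a
    continuous polar angle along an orbit is obtained. *)
Lemma polar_lift x y alpha :
  0 < x * cos alpha + y * sin alpha ->
  let theta := alpha + atan ((y * cos alpha - x * sin alpha) /
                             (x * cos alpha + y * sin alpha)) in
  x = sqrt (x ^ 2 + y ^ 2) * cos theta /\ y = sqrt (x ^ 2 + y ^ 2) * sin theta.
Proof.
  intros Hd theta; unfold theta.
  set (d := x * cos alpha + y * sin alpha) in *.
  set (c := y * cos alpha - x * sin alpha) in *.
  assert (H1 := sin2_cos2 alpha); unfold Rsqr in H1.
  rewrite cos_plus, sin_plus, cos_atan, sin_atan.
  assert (Hk : 0 < 1 + (c / d)²) by (assert (H := Rle_0_sqr (c / d)); lra).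
  assert (Hs := sqrt_lt_R0 _ Hk).
  assert (Hn : sqrt (x ^ 2 + y ^ 2) = d * sqrt (1 + (c / d)²)).
  { replace (x ^ 2 + y ^ 2) with (d * d * (1 + (c / d)²)).
    - rewrite sqrt_mult by nra. rewrite sqrt_square by lra. reflexivity.
    - replace (d * d * (1 + (c / d)²)) with (d * d + c * c)
        by (unfold Rsqr; field; lra).
      replace (x ^ 2 + y ^ 2)
        with ((x ^ 2 + y ^ 2) * (sin alpha * sin alpha + cos alpha * cos alpha))
        by (rewrite H1; ring).
      unfold c, d; ring. }
  rewrite Hn; split.
  - transitivity (d * cos alpha - c * sin alpha); [|field; lra].
    transitivity (x * (sin alpha * sin alpha + cos alpha * cos alpha));
      [rewrite H1|unfold c, d]; ring.
  - transitivity (d * sin alpha + c * cos alpha); [|field; lra].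
    transitivity (y * (sin alpha * sin alpha + cos alpha * cos alpha));
      [rewrite H1|unfold c, d]; ring.
Qed.

(** The angle is measured from the second axis, so that it increases along [u' = v, v' = - u]. The
    value [acos (b / r)] gives it up to sign, and the sign of [a] decides. *)
Lemma polar_coordinates a b : 0 < a ^ 2 + b ^ 2 ->
  exists phi, a = sqrt (a ^ 2 + b ^ 2) * sin phi /\ b = sqrt (a ^ 2 + b ^ 2) * cos phi.
Proof.
  intros H.
  assert (Hs := sqrt_lt_R0 _ H).
  set (r := sqrt (a ^ 2 + b ^ 2)) in *.
  assert (Hr : r * r = a ^ 2 + b ^ 2) by (apply sqrt_sqrt; lra).
  assert (Hb : -1 <= b / r <= 1).
  { split; [apply Rle_div_r|apply Rle_div_l]; nra. }
  assert (Hq : sqrt (1 - (b / r)²) = Rabs a / r).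
  { replace (1 - (b / r)²) with ((Rabs a / r)²).
    - apply sqrt_Rsqr, Rdiv_le_0_compat; [apply Rabs_pos|lra].
    - unfold Rsqr.
      replace (Rabs a / r * (Rabs a / r)) with (Rabs a ^ 2 / (r * r)) by (field; lra).
      rewrite pow2_abs.
      replace (1 - b / r * (b / r)) with ((r * r - b ^ 2) / (r * r)) by (field; lra).
      rewrite Hr at 2; f_equal; ring. }
  destruct (Rle_dec 0 a) as [Ha|Ha].
  - exists (acos (b / r)); rewrite sin_acos, cos_acos, Hq, Rabs_pos_eq by lra.
    split; field; lra.
  - exists (- acos (b / r)).
    rewrite sin_neg, cos_neg, sin_acos, cos_acos, Hq, Rabs_left by lra.
    split; field; lra.
Qed.

(** The equation [phi' = 1 / w phi] is solved by inverting the elapsed time [tau p], the integral of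
    [w] from [0] to [p]. The symmetry of [w] makes its mean over a turn equal to [1], so that a turn
    takes time [2 PI]. *)
Lemma angular_motion (w : R -> R) :
  (forall p, continuous w p) -> (forall p, 0 < w p) ->
  (forall p, w (p + 2 * PI) = w p) -> (forall p, w p + w (- p) = 2) ->
  exists Phi : R -> R,
    (forall t, derivable_pt_lim Phi t (/ w (Phi t))) /\
    (forall t, Phi (t + 2 * PI) = Phi t + 2 * PI) /\
    (forall s t, s < t -> Phi s < Phi t) /\
    (forall p, exists t, Phi t = p).
Proof.
  intros Hc Hpos Hper Hsym.
  assert (HPI := PI_RGT_0).
  set (tau := (fun p => RInt w 0 p) : R -> R).
  assert (Hd : forall p, derivable_pt_lim tau p (w p)).
  { intros p; apply is_derive_Reals, (is_derive_RInt w tau 0 p); [|apply Hc].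
    apply filter_forall; intros q; apply (RInt_correct w), (ex_RInt_continuous w).
    intros; apply Hc. }
  assert (H0 : tau 0 = 0) by exact (RInt_point 0 w).
  assert (Hinc : forall p q, p < q -> tau p < tau q).
  { intros p q Hpq.
    apply (increasing_of_pos_derivative tau w p q); try lra; split; auto. }
  (* The derivative of the left side is [w p + w (- p) = 2]. *)
  assert (Hrefl : forall p, tau p - tau (- p) = 2 * p).
  { intros p.
    assert (H := constant_of_null_derivative (fun p => tau p - tau (- p) - 2 * p) p).
    cbn beta in H; rewrite Ropp_0 in H.
    enough (tau p - tau (- p) - 2 * p = tau 0 - tau 0 - 2 * 0) by lra.
    apply H; intros q _; apply is_derive_Reals.
    replace 0 with (w q - (-1) * w (- q) - 2) by (specialize (Hsym q); lra).
    apply (is_derive_minus (fun p => tau p - tau (- p)) (fun p => 2 * p));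
      [|auto_derive; [trivial|ring]].
    apply (is_derive_minus tau (fun p => tau (- p))); [apply is_derive_Reals, Hd|].
    apply (is_derive_comp tau Ropp); [apply is_derive_Reals, Hd|auto_derive; trivial; ring]. }
  (* Periodicity of [w] makes the increment over a turn constant; at [p = - PI] the reflection
     identity evaluates it to [2 PI]. *)
  assert (Hshift : forall p, tau (p + 2 * PI) = tau p + 2 * PI).
  { assert (Hcst : forall p, tau (p + 2 * PI) - tau p = tau (0 + 2 * PI) - tau 0).
    { intros p.
      apply (constant_of_null_derivative (fun p => tau (p + 2 * PI) - tau p)).
      intros q _; apply is_derive_Reals.
      replace 0 with (1 * w (q + 2 * PI) - w q) by (rewrite Hper; ring).
      apply (is_derive_minus (fun p => tau (p + 2 * PI)) tau);
        [|apply is_derive_Reals, Hd].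
      apply (is_derive_comp tau (fun p => p + 2 * PI)); [apply is_derive_Reals, Hd|].
      auto_derive; trivial; ring. }
    intros p.
    assert (Hp := Hcst p); assert (Hm := Hcst (- PI)); assert (Hr := Hrefl PI).
    replace (- PI + 2 * PI) with PI in Hm by ring.
    lra. }
  (* These values show that [tau] is unbounded in both directions, so the intermediate value theorem
     gives surjectivity. *)
  assert (Hn : forall n, tau (INR n * (2 * PI)) = INR n * (2 * PI)).
  { induction n as [|n IH]; [simpl; rewrite Rmult_0_l; exact H0|].
    rewrite S_INR, Rmult_plus_distr_r, Rmult_1_l, Hshift, IH; ring. }
  assert (Hsurj : forall y, {p | tau p = y}).
  { intros y.
    destruct (nfloor_ex (Rabs y) (Rabs_pos y)) as [n [_ Hny]].
    set (b := INR (S n) * (2 * PI)).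
    assert (Hb : tau b = b) by apply Hn.
    assert (Hb' : tau (- b) = - b) by (specialize (Hrefl b); lra).
    assert (Hyb : Rabs y < b).
    { unfold b; rewrite S_INR.
      assert (H3 := PI2_1); assert (Hn0 := pos_INR n); nra. }
    assert (Hb0 := Rabs_pos y); apply Rabs_def2 in Hyb.
    destruct (f_interv_is_interv tau (- b) b y) as [p [_ Hp]]; [lra..| |exists p; exact Hp].
    intros x _; eapply derivable_pt_lim_continuity_pt, Hd. }
  assert (Hmono : forall p q, tau p < tau q -> p < q).
  { intros p q H; destruct (Rlt_or_le p q) as [|[Hl|He]]; trivial;
      [apply Hinc in Hl|rewrite He in H]; lra. }
  assert (Hle : forall p q, tau p <= tau q -> p <= q).
  { intros p q H; apply Rnot_lt_le; intros Hl; apply Hinc in Hl; lra. }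
  set (Phi := fun t => proj1_sig (Hsurj t)).
  assert (HPhi : forall t, tau (Phi t) = t) by (intros t; apply (proj2_sig (Hsurj t))).
  exists Phi; repeat split.
  - intros t.
    apply (inverse_derivable tau w Phi (Phi t - 1) (Phi t + 1)); [lra|auto| |].
    + intros z Hz; split; [|apply HPhi].
      split; apply Hle; rewrite HPhi; lra.
    + assert (H1 := Hinc (Phi t - 1) (Phi t)); assert (H2 := Hinc (Phi t) (Phi t + 1)).
      rewrite HPhi in H1, H2; lra.
  - intros t; apply Rle_antisym; apply Hle; rewrite Hshift, !HPhi; lra.
  - intros s t Hst; apply Hmono; rewrite !HPhi; exact Hst.
  - intros p; exists (tau p); apply Rle_antisym; apply Hle; rewrite HPhi; lra.
Qed.

(** * Isochronous systems with a given Urabe function *)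

(* [X] is the inverse of the function xi, and [1 / (p1 (X u) * Y u)] is
   [e^F] at the point [X u]. *)
Record urabe_chart (p1 q0 q2 h X Y : R -> R) (rho : R) : Prop := {
  uc_rho : 0 < rho;
  uc_X0 : X 0 = 0;
  uc_p1 : forall u, Rabs u < rho -> p1 (X u) < 0;
  uc_Y : forall u, Rabs u < rho -> Y u < 0;
  uc_h : forall u, Rabs u < rho -> 0 < 1 + h u;
  uc_odd : forall u, Rabs u < rho -> h (- u) = - h u;
  uc_cont : forall u, Rabs u < rho -> continuous h u;
  uc_dX : forall u, Rabs u < rho ->
    derivable_pt_lim X u ((1 + h u) * p1 (X u) * Y u);
  uc_dY : forall u, Rabs u < rho ->
    derivable_pt_lim Y u ((1 + h u) * q2 (X u) * Y u ^ 2);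
  uc_q0 : forall u, Rabs u < rho -> - (u * Y u) = (1 + h u) * q0 (X u)
}.

Lemma chart_slope_pos p1 q0 q2 h X Y rho u :
  urabe_chart p1 q0 q2 h X Y rho -> Rabs u < rho ->
  0 < (1 + h u) * p1 (X u) * Y u.
Proof.
  intros C Hu.
  assert (H1 := uc_p1 _ _ _ _ _ _ _ C u Hu).
  assert (H2 := uc_Y _ _ _ _ _ _ _ C u Hu).
  assert (H3 := uc_h _ _ _ _ _ _ _ C u Hu).
  assert (0 < p1 (X u) * Y u) by nra.
  rewrite Rmult_assoc; apply Rmult_lt_0_compat; assumption.
Qed.

Lemma chart_increasing p1 q0 q2 h X Y rho :
  urabe_chart p1 q0 q2 h X Y rho ->
  forall u v, Rabs u < rho -> Rabs v < rho -> u < v -> X u < X v.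
Proof.
  intros C u v Hu Hv Huv.
  apply (increasing_of_pos_derivative X (fun u => (1 + h u) * p1 (X u) * Y u) u v);
    try lra.
  intros x Hx.
  assert (Hx' : Rabs x < rho)
    by (apply Rabs_def2 in Hu; apply Rabs_def2 in Hv; apply Rabs_def1; lra).
  split; [eapply uc_dX; eassumption|eapply chart_slope_pos; eassumption].
Qed.

Lemma chart_injective p1 q0 q2 h X Y rho :
  urabe_chart p1 q0 q2 h X Y rho ->
  forall u v, Rabs u < rho -> Rabs v < rho -> X u = X v -> u = v.
Proof.
  intros C u v Hu Hv He.
  destruct (Rtotal_order u v) as [H|[H|H]]; [|exact H|];
    apply (chart_increasing _ _ _ _ _ _ _ C) in H; trivial; lra.
Qed.

Lemma chart_sign p1 q0 q2 h X Y rho :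
  urabe_chart p1 q0 q2 h X Y rho ->
  forall u, Rabs u < rho -> u <> 0 -> 0 < X u * u.
Proof.
  intros C u Hu Hn.
  assert (HX0 := uc_X0 _ _ _ _ _ _ _ C).
  assert (H0 : Rabs 0 < rho) by (rewrite Rabs_R0; apply C).
  destruct (Rtotal_order u 0) as [H|[H|H]]; [|contradiction|].
  - assert (H1 := chart_increasing _ _ _ _ _ _ _ C u 0 Hu H0 H); nra.
  - assert (H1 := chart_increasing _ _ _ _ _ _ _ C 0 u H0 Hu H); nra.
Qed.

Lemma chart_inverse p1 q0 q2 h X Y rho r0 x :
  urabe_chart p1 q0 q2 h X Y rho -> 0 < r0 < rho ->
  X (- r0) <= x <= X r0 -> {u | - r0 <= u <= r0 /\ X u = x}.
Proof.
  intros C Hr Hx.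
  apply f_interv_is_interv; [lra|exact Hx|].
  intros u Hu; eapply derivable_pt_lim_continuity_pt, uc_dX; [exact C|].
  apply Rabs_def1; lra.
Qed.

(** * Closed orbits in the chart and isochronicity *)

Lemma sq_lt_Rabs u r : 0 < r -> u ^ 2 < r ^ 2 -> Rabs u < r.
Proof. intros; apply Rabs_def1; nra. Qed.

Lemma sin_arg_bound r rho p : 0 < r < rho -> Rabs (r * sin p) < rho.
Proof. intros H; assert (Hb := SIN_bound p); apply Rabs_def1; nra. Qed.

(* In the coordinates [u = r sin phi], [v = r cos phi] the solution of the
   system is [(X u, v * Y u)] with [phi' = 1 / (1 + h u)]. *)
Lemma chart_closed_orbit P Q p1 q0 q2 h X Y rho u v :
  urabe_chart p1 q0 q2 h X Y rho ->
  (forall x y, P x y = p1 x * y) ->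
  (forall x y, Q x y = q0 x + q2 x * y ^ 2) ->
  0 < u ^ 2 + v ^ 2 < rho ^ 2 ->
  closed_orbit_surrounding_O P Q (X u) (v * Y u) (2 * PI).
Proof.
  intros C HP HQ Huv.
  assert (Hrho := uc_rho _ _ _ _ _ _ _ C).
  assert (HPI := PI_RGT_0).
  destruct (polar_coordinates u v (proj1 Huv)) as [phi0 [Hu0 Hv0]].
  set (r := sqrt (u ^ 2 + v ^ 2)) in *.
  assert (Hr : 0 < r < rho).
  { split; [apply sqrt_lt_R0; lra|].
    rewrite <- (sqrt_pow2 rho) by lra; apply sqrt_lt_1; lra. }
  assert (Hrs : forall p, Rabs (r * sin p) < rho)
    by (intros p; apply sin_arg_bound, Hr).
  (* [w] is the time spent per unit of angle on the circle of radius [r]; its symmetry comes from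
     the oddness of [h]. *)
  set (w := fun p => 1 + h (r * sin p)).
  destruct (angular_motion w) as [Phi [HdPhi [HPer [HInc HSurj]]]].
  - intros p; apply (continuous_plus (fun _ => 1)); [apply continuous_const|].
    apply (continuous_comp (fun p => r * sin p) h).
    + apply (ex_derive_continuous (fun p => r * sin p)); auto_derive; trivial.
    + apply (uc_cont _ _ _ _ _ _ _ C), Hrs.
  - intros p; apply (uc_h _ _ _ _ _ _ _ C), Hrs.
  - intros p; unfold w; rewrite sin_plus, sin_2PI, cos_2PI.
    f_equal; f_equal; ring.
  - intros p; unfold w.
    rewrite sin_neg, Ropp_mult_distr_r_reverse, (uc_odd _ _ _ _ _ _ _ C) by apply Hrs.
    ring.
  (* Time is shifted so that the orbit starts at the angle [phi0] of the given point. *)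
  - destruct (HSurj phi0) as [t0 Ht0].
    set (phi := fun t => Phi (t + t0)).
    assert (Hdphi : forall t, is_derive phi t (/ w (phi t))).
    { intros t; apply is_derive_Reals.
      replace (/ w (phi t)) with (/ w (phi t) * 1) by ring.
      apply is_derive_Reals.
      rewrite Rmult_comm.
      apply (is_derive_comp Phi (fun t => t + t0));
        [apply is_derive_Reals, HdPhi|auto_derive; trivial]. }
    assert (Hper : forall t, phi (t + 2 * PI) = phi t + 2 * PI).
    { intros t; unfold phi; rewrite <- HPer; f_equal; ring. }
    assert (Hphi0 : phi 0 = phi0) by (unfold phi; rewrite Rplus_0_l; exact Ht0).
    assert (Hmono : forall s t, s < t -> phi s < phi t)
      by (intros s t Hst; apply HInc; lra).
    clearbody phi.
    assert (Hw : forall p, 0 < w p) by (intros p; apply (uc_h _ _ _ _ _ _ _ C), Hrs).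
    set (x := fun t => X (r * sin (phi t))).
    set (y := fun t => r * cos (phi t) * Y (r * sin (phi t))).
    assert (HY : forall p, Y (r * sin p) < 0)
      by (intros p; apply (uc_Y _ _ _ _ _ _ _ C), Hrs).
    assert (Hs : forall t, is_derive (fun t => r * sin (phi t)) t
                   (r * (/ w (phi t) * cos (phi t)))).
    { intros t; apply (is_derive_scal (fun t => sin (phi t))).
      apply (is_derive_comp sin phi); [apply is_derive_sin|apply Hdphi]. }
    assert (Hc : forall t, is_derive (fun t => r * cos (phi t)) t
                   (r * (/ w (phi t) * - sin (phi t)))).
    { intros t; apply (is_derive_scal (fun t => cos (phi t))).
      apply (is_derive_comp cos phi); [apply is_derive_cos|apply Hdphi]. }
    assert (Hdx : forall t, is_derive x t (P (x t) (y t))).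
    { intros t; rewrite HP.
      assert (H := uc_dX _ _ _ _ _ _ _ C _ (Hrs (phi t))).
      apply is_derive_Reals in H.
      replace (p1 (x t) * y t) with
        (r * (/ w (phi t) * cos (phi t)) *
         ((1 + h (r * sin (phi t))) * p1 (X (r * sin (phi t))) * Y (r * sin (phi t)))).
      - apply (is_derive_comp X (fun t => r * sin (phi t))); [exact H|apply Hs].
      - specialize (Hw (phi t)); unfold x, y, w in *; field; lra. }
    assert (Hdy : forall t, is_derive y t (Q (x t) (y t))).
    { intros t; rewrite HQ.
      assert (H := uc_dY _ _ _ _ _ _ _ C _ (Hrs (phi t))).
      assert (Hq := uc_q0 _ _ _ _ _ _ _ C _ (Hrs (phi t))).
      apply is_derive_Reals in H.
      assert (Hw' := Hw (phi t)).
      replace (q0 (x t) + q2 (x t) * y t ^ 2) with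
        (r * (/ w (phi t) * - sin (phi t)) * Y (r * sin (phi t)) +
         r * cos (phi t) * (r * (/ w (phi t) * cos (phi t)) *
           ((1 + h (r * sin (phi t))) * q2 (X (r * sin (phi t)))
            * Y (r * sin (phi t)) ^ 2))).
      - apply (is_derive_mult (fun t => r * cos (phi t)) (fun t => Y (r * sin (phi t))));
          [apply Hc| |intros; apply Rmult_comm].
        apply (is_derive_comp Y (fun t => r * sin (phi t))); [exact H|apply Hs].
      - unfold x, y, w in *.
        replace (q0 (X (r * sin (phi t)))) with
          (- (r * sin (phi t) * Y (r * sin (phi t))) / (1 + h (r * sin (phi t))))
          by (rewrite Hq; field; lra).
        field; lra. }
    (* The direction of angle [phi - PI / 2] is [(sin phi, - cos phi)]. Since [X u] has the sign of
       [u] and [Y] is negative, the orbit point always has a positive component along it, as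
       [polar_lift] requires. *)
    assert (Hdot : forall t, 0 < x t * cos (phi t - PI / 2) + y t * sin (phi t - PI / 2)).
    { intros t.
      rewrite cos_minus, sin_minus, cos_PI2, sin_PI2.
      assert (Hy := HY (phi t)); unfold x, y.
      assert (H1 := sin2_cos2 (phi t)); unfold Rsqr in H1.
      set (s := sin (phi t)) in *; set (c := cos (phi t)) in *.
      replace (X (r * s) * (c * 0 + s * 1) + r * c * Y (r * s) * (s * 0 - c * 1))
        with (X (r * s) * s + r * - Y (r * s) * (c * c)) by ring.
      assert (Hc2 : 0 <= c * c) by apply Rle_0_sqr.
      assert (HrY : 0 < r * - Y (r * s)) by (apply Rmult_lt_0_compat; lra).
      destruct (Req_dec s 0) as [Hz|Hz].
      - rewrite Hz in H1; replace (c * c) with 1 by lra; rewrite Hz at 2; lra.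
      - assert (Hnz : r * s <> 0) by (apply Rmult_integral_contrapositive; lra).
        assert (Hsg := chart_sign _ _ _ _ _ _ _ C (r * s) (Hrs _) Hnz).
        assert (0 < X (r * s) * s) by nra.
        assert (0 <= r * - Y (r * s) * (c * c)) by (apply Rmult_le_pos; lra).
        lra. }
    set (theta := fun t => (phi t - PI / 2) +
      atan ((y t * cos (phi t - PI / 2) - x t * sin (phi t - PI / 2)) /
            (x t * cos (phi t - PI / 2) + y t * sin (phi t - PI / 2)))).
    assert (Hsin : forall t, sin (phi (t + 2 * PI)) = sin (phi t)).
    { intros t; rewrite Hper, sin_plus, sin_2PI, cos_2PI; ring. }
    assert (Hcos : forall t, cos (phi (t + 2 * PI)) = cos (phi t)).
    { intros t; rewrite Hper, cos_plus, sin_2PI, cos_2PI; ring. }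
    assert (Hxp : forall t, x (t + 2 * PI) = x t)
      by (intros t; unfold x; rewrite Hsin; reflexivity).
    assert (Hyp : forall t, y (t + 2 * PI) = y t)
      by (intros t; unfold y; rewrite Hsin, Hcos; reflexivity).
    exists x, y, theta.
    split; [|split; [|split; [|split; [|split; [|split; [|split; [|split; [|split]]]]]]]].
    + intros t; split; apply is_derive_Reals; [apply Hdx|apply Hdy].
    + unfold x; rewrite Hphi0, <- Hu0; reflexivity.
    + unfold y; rewrite Hphi0, <- Hu0, <- Hv0; reflexivity.
    + lra.
    + intros t; split; [apply Hxp|apply Hyp].
    (* Minimality of the period: injectivity of [X] and [Y u < 0] recover [sin phi] and [cos phi]
       from the point. An earlier return would make the cosine of an angle strictly between [0] and
       [2 PI] equal to [1]. *)
    + intros s HsT [Hx Hy].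
      assert (Hus : r * sin (phi s) = u).
      { apply (chart_injective _ _ _ _ _ _ _ C); [apply Hrs| |exact Hx].
        rewrite Hu0; apply Hrs. }
      unfold y in Hy; rewrite Hus in Hy.
      assert (HYu : Y u < 0) by (rewrite Hu0; apply HY).
      assert (Hvs : r * cos (phi s) = v) by (apply Rmult_eq_reg_r with (Y u); lra).
      assert (Hs1 : sin (phi s) = sin phi0) by (apply Rmult_eq_reg_l with r; lra).
      assert (Hc1 : cos (phi s) = cos phi0) by (apply Rmult_eq_reg_l with r; lra).
      assert (Hl : 0 < phi s - phi0 < 2 * PI).
      { rewrite <- Hphi0.
        assert (H1 := Hmono 0 s); assert (H2 := Hmono s (0 + 2 * PI)).
        rewrite Hper in H2; lra. }
      assert (H1 := sin2_cos2 phi0); unfold Rsqr in H1.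
      assert (Hcd : cos (phi s - phi0) = 1) by (rewrite cos_minus, Hs1, Hc1; lra).
      assert (Hh : 0 < sin ((phi s - phi0) / 2)) by (apply sin_gt_0; lra).
      replace (phi s - phi0) with (2 * ((phi s - phi0) / 2)) in Hcd by field.
      rewrite cos_2a_sin in Hcd; nra.
    + intros t [Hx Hy]; specialize (Hdot t); rewrite Hx, Hy in Hdot; lra.
    + intros t; apply continuity_pt_filterlim, (ex_derive_continuous theta).
      assert (H1 : ex_derive phi t) by (eexists; apply Hdphi).
      assert (H2 : ex_derive x t) by (eexists; apply Hdx).
      assert (H3 : ex_derive y t) by (eexists; apply Hdy).
      assert (H4 := Hdot t).
      unfold theta; auto_derive; repeat split; trivial.
      unfold Rminus, Rdiv in H4; lra.
    + intros t; apply (polar_lift (x t) (y t) (phi t - PI / 2)), Hdot.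
    (* Over one period the [atan] term returns to its value while [phi] gains [2 PI], so the orbit
       winds once around the origin. *)
    + unfold theta.
      assert (Hp2 : phi (2 * PI) = phi 0 + 2 * PI) by (rewrite <- Hper; f_equal; ring).
      assert (Hx2 : x (2 * PI) = x 0) by (rewrite <- (Hxp 0); f_equal; ring).
      assert (Hy2 : y (2 * PI) = y 0) by (rewrite <- (Hyp 0); f_equal; ring).
      rewrite Hx2, Hy2, Hp2.
      replace (phi 0 + 2 * PI - PI / 2) with (phi 0 - PI / 2 + 2 * PI) by ring.
      rewrite sin_plus, cos_plus, sin_2PI, cos_2PI, !Rmult_0_r, !Rmult_1_r,
        Rminus_0_r, Rplus_0_r.
      lra.
Qed.

(** The points [(X u, v * Y u)] with [u^2 + v^2 < rho^2] fill a neighbourhood of the origin: [u] is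
    found from [x] by the intermediate value theorem, and [v = y / Y u] is small because [Y] stays
    away from [0]. *)
Lemma chart_isochronous_center P Q p1 q0 q2 h X Y rho :
  urabe_chart p1 q0 q2 h X Y rho ->
  (forall x y, P x y = p1 x * y) ->
  (forall x y, Q x y = q0 x + q2 x * y ^ 2) ->
  is_isochronous_center P Q.
Proof.
  intros C HP HQ.
  assert (Hrho := uc_rho _ _ _ _ _ _ _ C).
  assert (HX0 := uc_X0 _ _ _ _ _ _ _ C).
  assert (Hz : Rabs 0 < rho) by (rewrite Rabs_R0; exact Hrho).
  assert (HY0 := uc_Y _ _ _ _ _ _ _ C 0 Hz).
  assert (Hc0 : continuity_pt Y 0)
    by (eapply derivable_pt_lim_continuity_pt, (uc_dY _ _ _ _ _ _ _ C), Hz).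
  destruct (Hc0 (- Y 0 / 2) ltac:(lra)) as [e [He Hcont]].
  (* The bound [rho / 2] puts the square of half-side [r0] inside the disc of radius [rho]; the
     bound [e / 2] ensures [Y u <= Y 0 / 2] there. *)
  set (r0 := Rmin (rho / 2) (e / 2)).
  assert (Hr0 : 0 < r0 /\ r0 <= rho / 2 /\ r0 <= e / 2).
  { unfold r0; split; [apply Rmin_glb_lt; lra|split; [apply Rmin_l|apply Rmin_r]]. }
  set (c := - Y 0 / 2).
  assert (HYc : forall u, - r0 <= u <= r0 -> Y u <= - c).
  { intros u Hu; unfold c.
    destruct (Req_dec u 0) as [->|Hn]; [lra|].
    assert (H : Rabs (Y u - Y 0) < - Y 0 / 2).
    { apply Hcont; split; [split; [exact I|auto]|].
      simpl; unfold Rdist; rewrite Rminus_0_r; apply Rabs_def1; lra. }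
    apply Rabs_def2 in H; lra. }
  assert (Hc : 0 < c) by (unfold c; lra).
  assert (Hra : Rabs r0 < rho) by (apply Rabs_def1; lra).
  assert (Hrb : Rabs (- r0) < rho) by (apply Rabs_def1; lra).
  assert (Hp : 0 < X r0).
  { rewrite <- HX0; apply (chart_increasing _ _ _ _ _ _ _ C); trivial; lra. }
  assert (Hm : X (- r0) < 0).
  { rewrite <- HX0; apply (chart_increasing _ _ _ _ _ _ _ C); trivial; lra. }
  (* The first two bounds place [x] in the range of [X] on [[- r0, r0]]; the third yields [|v| < r0]
     from [|Y u| >= c]. *)
  set (d := Rmin (Rmin (X r0) (- X (- r0))) (c * r0)).
  assert (Hd : 0 < d /\ d <= X r0 /\ d <= - X (- r0) /\ d <= c * r0).
  { unfold d; repeat split.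
    - apply Rmin_glb_lt; [apply Rmin_glb_lt; lra|nra].
    - eapply Rle_trans; apply Rmin_l.
    - eapply Rle_trans; [apply Rmin_l|apply Rmin_r].
    - apply Rmin_r. }
  exists d, (2 * PI); split; [apply Hd|].
  intros x y Hxy.
  assert (Hx : Rabs x < d) by (apply sq_lt_Rabs; nra).
  assert (Hy : Rabs y < d) by (apply sq_lt_Rabs; nra).
  apply Rabs_def2 in Hx.
  destruct (chart_inverse _ _ _ _ _ _ _ r0 x C) as [u [Hu HXu]]; [lra..|].
  assert (HYu := HYc u Hu).
  set (v := y / Y u).
  assert (Hyv : v * Y u = y) by (unfold v; field; lra).
  rewrite <- HXu, <- Hyv.
  apply (chart_closed_orbit P Q p1 q0 q2 h X Y rho); trivial.
  assert (Hv : Rabs v < r0).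
  { assert (Hy' : Rabs v * - Y u = Rabs y)
      by (rewrite <- (Rabs_left (Y u)), <- Rabs_mult by lra; f_equal; exact Hyv).
    assert (H0 := Rabs_pos v); nra. }
  apply Rabs_def2 in Hv.
  split; [|nra].
  destruct (Req_dec u 0) as [Hu0|]; [|nra].
  destruct (Req_dec v 0) as [Hv0|]; [|nra].
  assert (Hx0 : x = 0) by (rewrite <- HXu, Hu0; exact HX0).
  assert (Hy0 : y = 0) by (rewrite <- Hyv, Hv0; ring).
  rewrite Hx0, Hy0 in Hxy; nra.
Qed.

(* Here [xi = X^-1], [F = - ln (p1 * Y (X^-1))] and [G = xi^2 / 2]. *)
Lemma chart_urabe_relation p1 dp1 q0 q2 h X Y rho :
  urabe_chart p1 q0 q2 h X Y rho ->
  (forall s, derivable_pt_lim p1 s (dp1 s)) ->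
  p1 0 * Y 0 = 1 ->
  urabe_relation (fun s => - (q2 s + dp1 s) / p1 s) (fun s => - (p1 s * q0 s)) h.
Proof.
  intros C Hdp Hnorm.
  assert (Hrho := uc_rho _ _ _ _ _ _ _ C).
  assert (HX0 := uc_X0 _ _ _ _ _ _ _ C).
  set (r0 := rho / 2).
  assert (Hr0 : 0 < r0 < rho) by (unfold r0; lra).
  assert (Hz : Rabs 0 < rho) by (rewrite Rabs_R0; exact Hrho).
  assert (Hra : Rabs r0 < rho) by (apply Rabs_def1; lra).
  assert (Hrb : Rabs (- r0) < rho) by (apply Rabs_def1; lra).
  assert (Hp : 0 < X r0).
  { rewrite <- HX0; apply (chart_increasing _ _ _ _ _ _ _ C); trivial; lra. }
  assert (Hm : X (- r0) < 0).
  { rewrite <- HX0; apply (chart_increasing _ _ _ _ _ _ _ C); trivial; lra. }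
  (* The inverse is made total by the default value [0] outside [[X (- r0), X r0]]. *)
  assert (Hinv : forall x, {u | X (- r0) <= x <= X r0 -> - r0 <= u <= r0 /\ X u = x}).
  { intros x.
    destruct (Rle_dec (X (- r0)) x) as [H1|H1]; [|exists 0; intros []; contradiction].
    destruct (Rle_dec x (X r0)) as [H2|H2]; [|exists 0; intros []; contradiction].
    destruct (chart_inverse _ _ _ _ _ _ _ r0 x C Hr0 (conj H1 H2)) as [u Hu].
    exists u; intros _; exact Hu. }
  set (Xi := fun x => proj1_sig (Hinv x)).
  assert (HXi : forall x, X (- r0) <= x <= X r0 -> - r0 <= Xi x <= r0 /\ X (Xi x) = x)
    by (intros x; apply (proj2_sig (Hinv x))).
  clearbody Xi.
  assert (HXir : forall x, X (- r0) <= x <= X r0 -> Rabs (Xi x) < rho).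
  { intros x Hx; apply HXi in Hx; apply Rabs_def1; lra. }
  assert (HXi0 : Xi 0 = 0).
  { apply (chart_injective _ _ _ _ _ _ _ C); [apply HXir; lra|exact Hz|].
    rewrite HX0; apply HXi; lra. }
  assert (Hm1 : forall x, X (- r0) <= x <= X r0 -> p1 x < 0).
  { intros x Hx; destruct (HXi x Hx) as [_ He]; rewrite <- He.
    apply (uc_p1 _ _ _ _ _ _ _ C), HXir, Hx. }
  assert (HYn : forall x, X (- r0) <= x <= X r0 -> Y (Xi x) < 0).
  { intros x Hx; apply (uc_Y _ _ _ _ _ _ _ C), HXir, Hx. }
  assert (Hhn : forall x, X (- r0) <= x <= X r0 -> 0 < 1 + h (Xi x)).
  { intros x Hx; apply (uc_h _ _ _ _ _ _ _ C), HXir, Hx. }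
  assert (Hq : forall x, X (- r0) <= x <= X r0 ->
                - (Xi x * Y (Xi x)) = (1 + h (Xi x)) * q0 x).
  { intros x Hx; rewrite (uc_q0 _ _ _ _ _ _ _ C) by apply HXir, Hx.
    rewrite (proj2 (HXi x Hx)); reflexivity. }
  assert (HdXi : forall x, X (- r0) < x < X r0 ->
            is_derive Xi x (/ ((1 + h (Xi x)) * p1 x * Y (Xi x)))).
  { intros x Hx; apply is_derive_Reals.
    assert (He := proj2 (HXi x ltac:(lra))).
    replace (p1 x) with (p1 (X (Xi x))) by (rewrite He; reflexivity).
    apply (inverse_derivable X (fun u => (1 + h u) * p1 (X u) * Y u) Xi (- r0) r0);
      [lra| |exact HXi|exact Hx].
    intros u Hu.
    assert (Hu' : Rabs u < rho) by (apply Rabs_def1; lra).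
    split; [eapply uc_dX; eassumption|eapply chart_slope_pos; eassumption]. }
  assert (Hmpos : forall x, X (- r0) <= x <= X r0 -> 0 < p1 x * Y (Xi x)).
  { intros x Hx; specialize (Hm1 x Hx); specialize (HYn x Hx); nra. }
  assert (HF : forall x, X (- r0) <= x <= X r0 ->
             exp (- ln (p1 x * Y (Xi x))) = / (p1 x * Y (Xi x))).
  { intros x Hx; rewrite exp_Ropp, exp_ln by apply Hmpos, Hx; reflexivity. }
  exists (Rmin (X r0) (- X (- r0))), (fun x => - ln (p1 x * Y (Xi x))),
    (fun x => Xi x ^ 2 / 2).
  assert (Heps : forall s, Rabs s < Rmin (X r0) (- X (- r0)) -> X (- r0) < s < X r0).
  { intros s Hs; apply Rabs_def2 in Hs.
    assert (H1 := Rmin_l (X r0) (- X (- r0))).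
    assert (H2 := Rmin_r (X r0) (- X (- r0))); lra. }
  split; [apply Rmin_glb_lt; lra|].
  (* The normalisation [p1 0 * Y 0 = 1] is exactly [F 0 = 0]. *)
  split; [rewrite HXi0, Hnorm, ln_1; ring|].
  split; [rewrite HXi0; field|].
  split.
  - intros s Hs; apply Heps in Hs.
    assert (Hs' : X (- r0) <= s <= X r0) by lra.
    assert (Hd := HdXi s Hs).
    specialize (Hm1 s Hs'); specialize (HYn s Hs'); specialize (Hhn s Hs').
    specialize (Hmpos s Hs'); specialize (Hq s Hs').
    split; apply is_derive_Reals.
    (* The identity for [Y'] makes the logarithmic derivative of [Y (Xi x)] equal to [q2 / p1];
       adding that of [p1] and changing sign gives [f]. *)
    + assert (HdY : is_derive (fun x => Y (Xi x)) s
                (/ ((1 + h (Xi s)) * p1 s * Y (Xi s)) *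
                 ((1 + h (Xi s)) * q2 s * Y (Xi s) ^ 2))).
      { apply (is_derive_comp Y Xi); [|exact Hd].
        apply is_derive_Reals; replace (q2 s) with (q2 (X (Xi s)))
          by (rewrite (proj2 (HXi s Hs')); reflexivity).
        apply (uc_dY _ _ _ _ _ _ _ C), HXir, Hs'. }
      assert (Hdp1 : is_derive p1 s (dp1 s)) by apply is_derive_Reals, Hdp.
      assert (Hprod := is_derive_mult p1 (fun x => Y (Xi x)) s _ _ Hdp1 HdY
                         ltac:(intros; apply Rmult_comm)).
      assert (Hln := is_derive_comp ln _ s _ _
                       (proj2 (is_derive_Reals _ _ _) (derivable_pt_lim_ln _ Hmpos)) Hprod).
      apply is_derive_opp in Hln.
      refine (eq_ind _ (fun l => is_derive _ s l) Hln _ _).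
      unfold opp, scal, plus, mult; simpl; unfold mult; simpl.
      field; lra.
    (* The identity for [q0] turns [g e^(2F)] into [Xi' * Xi], the derivative of [Xi^2 / 2]. *)
    + replace (- (p1 s * q0 s) * exp (2 * - ln (p1 s * Y (Xi s))))
        with (/ ((1 + h (Xi s)) * p1 s * Y (Xi s)) * Xi s).
      * assert (He : ex_derive Xi s) by (eexists; exact Hd).
        auto_derive; [exact He|].
        replace (Derive (fun x => Xi x) s) with (/ ((1 + h (Xi s)) * p1 s * Y (Xi s)))
          by (symmetry; apply is_derive_unique, Hd).
        field; lra.
      * replace (2 * - ln (p1 s * Y (Xi s)))
          with (- ln (p1 s * Y (Xi s)) + - ln (p1 s * Y (Xi s))) by ring.
        rewrite exp_plus, HF by exact Hs'.
        replace (q0 s) with (- (Xi s * Y (Xi s)) / (1 + h (Xi s)))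
          by (rewrite Hq; field; lra).
        field; lra.
  - intros x xi [Hx0 Hx] HG Hsg; apply Heps in Hx.
    assert (Hx' : X (- r0) <= x <= X r0) by lra.
    assert (Hn : Xi x <> 0).
    { intros H; assert (He := proj2 (HXi x Hx')); rewrite H, HX0 in He.
      rewrite <- He, Rabs_R0 in Hx0; lra. }
    assert (Hs := chart_sign _ _ _ _ _ _ _ C _ (HXir x Hx') Hn).
    rewrite (proj2 (HXi x Hx')) in Hs.
    (* The squares agree, and both numbers have the sign of [x]. *)
    assert (xi = Xi x) as ->.
    { assert (H : (xi - Xi x) * (xi + Xi x) = 0) by nra.
      apply Rmult_integral in H; destruct H as [H|H]; [lra|].
      replace xi with (- Xi x) in Hsg by lra; nra. }
    rewrite HF by exact Hx'.
    specialize (Hm1 x Hx'); specialize (HYn x Hx'); specialize (Hhn x Hx').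
    specialize (Hq x Hx').
    replace (q0 x) with (- (Xi x * Y (Xi x)) / (1 + h (Xi x)))
      by (rewrite Hq; field; lra).
    field; lra.
Qed.

(** * Urabe functions of the form [c u / sqrt (A + B u^2)] *)

Definition sqrt_quad (A B u : R) : R := sqrt (A + B * u ^ 2).

Lemma sqrt_quad_pos A B u : 0 < A + B * u ^ 2 -> 0 < sqrt_quad A B u.
Proof. apply sqrt_lt_R0. Qed.

Lemma sqrt_quad_sqr A B u : 0 < A + B * u ^ 2 ->
  sqrt_quad A B u * sqrt_quad A B u = A + B * u ^ 2.
Proof. intros H; apply sqrt_sqrt; lra. Qed.

(** With [k] of either sign, this gives the positivity of the factors [S - k u] that occur in the
    charts. *)
Lemma sqrt_quad_ge A B k u : 0 < A + B * u ^ 2 -> k ^ 2 * u ^ 2 < A + B * u ^ 2 ->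
  k * u < sqrt_quad A B u.
Proof.
  intros H Hk.
  assert (H1 := sqrt_quad_pos A B u H); assert (H2 := sqrt_quad_sqr A B u H).
  nra.
Qed.

Lemma is_derive_sqrt_quad A B u : 0 < A + B * u ^ 2 ->
  is_derive (sqrt_quad A B) u (B * u / sqrt_quad A B u).
Proof.
  intros H; unfold sqrt_quad.
  assert (H1 := sqrt_quad_pos A B u H); unfold sqrt_quad in H1.
  auto_derive; [exact H|simpl in *; field; lra].
Qed.

Lemma linear_div_sqrt_quad_odd c A B u :
  c * - u / sqrt_quad A B (- u) = - (c * u / sqrt_quad A B u).
Proof.
  unfold sqrt_quad; replace ((- u) ^ 2) with (u ^ 2) by ring.
  unfold Rdiv; ring.
Qed.

Lemma linear_div_sqrt_quad_continuous c A B u : 0 < A + B * u ^ 2 ->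
  continuous (fun u => c * u / sqrt_quad A B u) u.
Proof.
  intros H; apply (ex_derive_continuous (fun u => c * u / sqrt_quad A B u)).
  assert (H1 := sqrt_quad_pos A B u H).
  auto_derive; split; [eexists; apply is_derive_sqrt_quad, H|lra].
Qed.

(** What remains for each system is a list of sign conditions and the three identities for explicit
    [X] and [Y]. *)
Lemma isochronous_center_with_urabe_function
    P Q p1 dp1 q0 q2 c A B X Y rho (h : R -> R) :
  0 < A -> 0 < rho ->
  (forall u, Rabs u < rho -> 0 < A + B * u ^ 2) ->
  (forall u, h u = c * u / sqrt_quad A B u) ->
  (forall x y, P x y = p1 x * y) ->
  (forall x y, Q x y = q0 x + q2 x * y ^ 2) ->
  (forall s, derivable_pt_lim p1 s (dp1 s)) ->
  p1 0 * Y 0 = 1 ->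
  X 0 = 0 ->
  (forall u, Rabs u < rho ->
     (p1 (X u) < 0 /\ Y u < 0 /\ 0 < 1 + c * u / sqrt_quad A B u) /\
     - (u * Y u) = (1 + c * u / sqrt_quad A B u) * q0 (X u) /\
     is_derive X u ((1 + c * u / sqrt_quad A B u) * p1 (X u) * Y u) /\
     is_derive Y u ((1 + c * u / sqrt_quad A B u) * q2 (X u) * Y u ^ 2)) ->
  is_isochronous_center P Q /\ is_urabe_function P Q h.
Proof.
  intros HA Hrho Hpos Hh HP HQ Hdp Hnorm HX0 H.
  assert (C : urabe_chart p1 q0 q2 h X Y rho).
  { split; trivial; intros u Hu; specialize (H u Hu); rewrite ?Hh;
      try apply is_derive_Reals; try apply H.
    - apply linear_div_sqrt_quad_odd.
    - apply (continuous_ext (fun u => c * u / sqrt_quad A B u));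
        [intros; symmetry; apply Hh|].
      apply linear_div_sqrt_quad_continuous, Hpos, Hu. }
  split; [eapply chart_isochronous_center; eassumption|].
  exists p1, q0, q2, dp1.
  split; [exact HP|]. split; [exact HQ|].
  split; [intros H0; rewrite H0 in Hnorm; lra|].
  split.
  { assert (H0 : Rabs 0 < rho) by (rewrite Rabs_R0; exact Hrho).
    assert (Hq := uc_q0 _ _ _ _ _ _ _ C 0 H0).
    assert (H1 := uc_h _ _ _ _ _ _ _ C 0 H0).
    rewrite HX0 in Hq; nra. }
  split; [exact Hdp|].
  split; [exists rho; split; [exact Hrho|apply C]|].
  split; [|eapply chart_urabe_relation; eassumption].
  destruct (analytic_linear_div_sqrt c A B HA) as [r [a [Hr Ha]]].
  exists r, a; split; [exact Hr|].
  intros u Hu; rewrite Hh; apply Ha, Hu.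
Qed.

(** * Verification of the charts of the four systems *)

Ltac poly_derivative :=
  intros; apply is_derive_Reals; auto_derive; [trivial|field].

Ltac derive_quad A B u Hd :=
  auto_derive;
  [|replace (Derive (fun x => sqrt_quad A B x) u) with (B * u / sqrt_quad A B u)
      by (symmetry; apply is_derive_unique, Hd)].

(** Since [S^2 - u^2 = 1], the quantity [E = u + S] satisfies [E - 1 / E = 2 u] and
    [E + 1 / E = 2 S]; every identity becomes rational in [E]. *)
Lemma isochronous_system4 : is_isochronous_center P4 Q4 /\ is_urabe_function P4 Q4 h4.
Proof.
  apply (isochronous_center_with_urabe_function P4 Q4
    (fun x => - 1 + x) (fun _ => 1)
    (fun x => x - 3/2 * x^2 + x^3 - 1/4 * x^4) (fun _ => 1) 1 1 1
    (fun u => 1 - / (u + sqrt_quad 1 1 u)) (fun u => - / (u + sqrt_quad 1 1 u)) 1);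
    try lra.
  - intros; nra.
  - intros u; unfold h4, sqrt_quad; rewrite !Rmult_1_l; reflexivity.
  - intros; unfold P4; ring.
  - intros; unfold Q4; field.
  - poly_derivative.
  - unfold sqrt_quad; replace (1 + 1 * 0 ^ 2) with 1 by ring; rewrite sqrt_1; field.
  - unfold sqrt_quad; replace (1 + 1 * 0 ^ 2) with 1 by ring; rewrite sqrt_1; field.
  - intros u _.
    assert (H : 0 < 1 + 1 * u ^ 2) by nra.
    assert (Hd := is_derive_sqrt_quad _ _ _ H).
    assert (HS := sqrt_quad_sqr _ _ _ H).
    assert (H1 := sqrt_quad_pos _ _ _ H).
    assert (H2 : -1 * u < sqrt_quad 1 1 u) by (apply sqrt_quad_ge; lra).
    assert (Hex : ex_derive (sqrt_quad 1 1) u) by (eexists; exact Hd).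
    set (E := u + sqrt_quad 1 1 u).
    assert (HE : 0 < E) by (unfold E; lra).
    assert (HuE : u = (E - / E) / 2).
    { apply Rmult_eq_reg_r with (2 * E); [|lra].
      replace ((E - / E) / 2 * (2 * E)) with (E * E - 1) by (field; lra).
      unfold E; nra. }
    assert (HSE : sqrt_quad 1 1 u = (E + / E) / 2) by (unfold E in *; lra).
    assert (HiE := Rinv_0_lt_compat _ HE).
    assert (HEE : 0 < 1 + E ^ 2) by nra.
    split; [|split; [|split]].
    + fold E; split; [lra|split; [lra|]].
      replace (1 + 1 * u / sqrt_quad 1 1 u) with (E / sqrt_quad 1 1 u)
        by (unfold E; field; lra).
      apply Rdiv_lt_0_compat; lra.
    + fold E; rewrite HSE, HuE; field; lra.
    + derive_quad 1 1 u Hd; [repeat split; trivial; fold E; lra|].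
      fold E; rewrite HSE, HuE; field; lra.
    + derive_quad 1 1 u Hd; [repeat split; trivial; fold E; lra|].
      fold E; rewrite HSE, HuE; field; lra.
Qed.

Lemma isochronous_system3 a : is_isochronous_center (P3 a) (Q3 a) /\
  is_urabe_function (P3 a) (Q3 a) (h3 a).
Proof.
  assert (Ha := Rabs_pos a).
  assert (Hrho : 0 < / (1 + 3 * Rabs a)) by (apply Rinv_0_lt_compat; lra).
  (* The radius gives [|u| < 1] and [3 |a| u^2 < 1], hence [27 a u^2 < 9]; this inequality amounts
     to [u^2 < S^2] and makes [S + u] positive. *)
  assert (Hpos : forall u, Rabs u < / (1 + 3 * Rabs a) -> u ^ 2 < 9 + (1 - 27 * a) * u ^ 2).
  { intros u Hu.
    assert (Hu0 := Rabs_pos u).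
    assert (H : Rabs u * (1 + 3 * Rabs a) < 1).
    { apply Rlt_div_r; [lra|]; unfold Rdiv; rewrite Rmult_1_l; exact Hu. }
    assert (H1 : Rabs u < 1) by nra.
    assert (H2 : 3 * Rabs a * Rabs u ^ 2 < 1) by nra.
    rewrite pow2_abs in H2.
    assert (H3 := Rle_abs a); assert (H4 := pow2_ge_0 u); nra. }
  apply (isochronous_center_with_urabe_function (P3 a) (Q3 a)
    (fun x => - 1 + x - (3 * a + 2/9) * x^2 + a * x^3)
    (fun x => 1 - 2 * (3 * a + 2/9) * x + 3 * a * x^2)
    (fun x => x) (fun x => (1/9 - 3 * a) * x) 1 9 (1 - 27 * a)
    (fun u => 3 * u / (sqrt_quad 9 (1 - 27 * a) u + u))
    (fun u => - 3 / sqrt_quad 9 (1 - 27 * a) u) (/ (1 + 3 * Rabs a)));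
    try lra.
  - intros u Hu; specialize (Hpos u Hu); nra.
  - intros u; unfold h3, sqrt_quad; rewrite Rmult_1_l, (Rplus_comm 9); reflexivity.
  - intros; unfold P3; ring.
  - intros; unfold Q3; ring.
  - poly_derivative.
  - unfold sqrt_quad; replace (9 + (1 - 27 * a) * 0 ^ 2) with (3 * 3) by ring.
    rewrite sqrt_square by lra; field.
  - intros u Hu; specialize (Hpos u Hu).
    assert (H : 0 < 9 + (1 - 27 * a) * u ^ 2) by nra.
    assert (Hd := is_derive_sqrt_quad _ _ _ H).
    assert (HS := sqrt_quad_sqr _ _ _ H).
    assert (H1 := sqrt_quad_pos _ _ _ H).
    assert (H2 : -1 * u < sqrt_quad 9 (1 - 27 * a) u) by (apply sqrt_quad_ge; lra).
    assert (Hex : ex_derive (sqrt_quad 9 (1 - 27 * a)) u) by (eexists; exact Hd).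
    set (S := sqrt_quad 9 (1 - 27 * a) u) in *.
    assert (HS2 : S ^ 2 = 9 + u ^ 2 - 27 * a * u ^ 2) by (simpl in *; lra).
    (* The numerator collapses to [- S (S^2 - (1 - 27 a) u^2) = - 9 S], which also shows the sign of
       [p1 (X u)]. *)
    assert (Hp : - 1 + 3 * u / (S + u) - (3 * a + 2/9) * (3 * u / (S + u))^2
                 + a * (3 * u / (S + u))^3 = - (9 * S / (S + u) ^ 3)).
    { field_simplify_eq; [ring [HS2]|lra]. }
    split; [|split; [|split]].
    + split; [|split].
      * rewrite Hp; apply Ropp_lt_gt_0_contravar, Rdiv_lt_0_compat; [lra|].
        apply pow_lt; lra.
      * replace (- 3 / S) with (- (3 / S)) by (field; lra).
        apply Ropp_lt_gt_0_contravar, Rdiv_lt_0_compat; lra.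
      * replace (1 + 1 * u / S) with ((S + u) / S) by (field; lra).
        apply Rdiv_lt_0_compat; lra.
    + field; lra.
    + rewrite Hp; derive_quad 9 (1 - 27 * a) u Hd; [repeat split; trivial; fold S; lra|].
      fold S; field_simplify_eq; [ring [HS2]|lra].
    + derive_quad 9 (1 - 27 * a) u Hd; [repeat split; trivial; fold S; lra|].
      fold S; field_simplify_eq; [ring [HS2]|lra].
Qed.

(* With [T = 2 * X u + 1] and [V = S - u], where [S = sqrt (4 + 49 * u^2)],
   both [u] and [S] are rational in [T] and [V]. *)
Lemma isochronous_system2 : is_isochronous_center P2 Q2 /\ is_urabe_function P2 Q2 h2.
Proof.
  apply (isochronous_center_with_urabe_function P2 Q2
    (fun x => - 1 + x + 9 * x^2 + 6 * x^3) (fun x => 1 + 18 * x + 18 * x^2)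
    (fun x => x + 3/2 * x^2 + x^3 + 1/2 * x^4)
    (fun x => - (1/2) + 12 * x + 12 * x^2) (-1) 4 49
    (fun u => (sqrt ((sqrt_quad 4 49 u + 7 * u) / (sqrt_quad 4 49 u - u)) - 1) / 2)
    (fun u => - 2 / (sqrt_quad 4 49 u - u)) 1);
    try lra.
  - intros; nra.
  - intros u; unfold h2, sqrt_quad; f_equal; ring.
  - intros; unfold P2; ring.
  - intros; unfold Q2; field.
  - poly_derivative.
  - unfold sqrt_quad; replace (4 + 49 * 0 ^ 2) with (2 * 2) by ring.
    rewrite sqrt_square by lra; field.
  - unfold sqrt_quad; replace (4 + 49 * 0 ^ 2) with (2 * 2) by ring.
    rewrite sqrt_square by lra; replace ((2 + 7 * 0) / (2 - 0)) with 1 by field.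
    rewrite sqrt_1; field.
  - intros u _.
    assert (H : 0 < 4 + 49 * u ^ 2) by nra.
    assert (Hd := is_derive_sqrt_quad _ _ _ H).
    assert (HS := sqrt_quad_sqr _ _ _ H).
    assert (H1 := sqrt_quad_pos _ _ _ H).
    assert (H2 : 1 * u < sqrt_quad 4 49 u) by (apply sqrt_quad_ge; nra).
    assert (H3 : -7 * u < sqrt_quad 4 49 u) by (apply sqrt_quad_ge; lra).
    assert (H4 : 7 * u < sqrt_quad 4 49 u) by (apply sqrt_quad_ge; lra).
    assert (Hex : ex_derive (sqrt_quad 4 49) u) by (eexists; exact Hd).
    assert (HW : 0 < (sqrt_quad 4 49 u + 7 * u) / (sqrt_quad 4 49 u - u))
      by (apply Rdiv_lt_0_compat; lra).
    set (T := sqrt ((sqrt_quad 4 49 u + 7 * u) / (sqrt_quad 4 49 u - u))).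
    assert (HT : 0 < T) by (apply sqrt_lt_R0; exact HW).
    assert (HTT : T * T = (sqrt_quad 4 49 u + 7 * u) / (sqrt_quad 4 49 u - u))
      by (apply sqrt_sqrt; lra).
    set (V := sqrt_quad 4 49 u - u).
    assert (HV : 0 < V) by (unfold V; lra).
    assert (HVT : V * T ^ 2 = sqrt_quad 4 49 u + 7 * u).
    { replace (T ^ 2) with (T * T) by ring; rewrite HTT; unfold V; field; lra. }
    assert (Hu : u = V * (T ^ 2 - 1) / 8) by (unfold V in *; lra).
    assert (HSV : sqrt_quad 4 49 u = V * (T ^ 2 + 7) / 8) by (unfold V in *; lra).
    (* Indeed [V (7 - 3 T^2) = 4 (S - 7 u)]. *)
    assert (HN : 0 < 7 - 3 * T ^ 2).
    { assert (0 < V * (7 - 3 * T ^ 2)) by (unfold V in *; lra). nra. }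
    assert (Hh : 1 + -1 * u / sqrt_quad 4 49 u = 8 / (T ^ 2 + 7)).
    { rewrite HSV, Hu at 1; field; split; nra. }
    (* The cubic [p1] is odd about [x = - 1/2], so it is an odd polynomial in [T = 2 x + 1]. *)
    assert (Hp : - 1 + (T - 1) / 2 + 9 * ((T - 1) / 2) ^ 2 + 6 * ((T - 1) / 2) ^ 3
                 = - (T * (7 - 3 * T ^ 2) / 4)) by field.
    split; [|split; [|split]].
    + fold V T; rewrite Hp, Hh; split; [|split].
      * apply Ropp_lt_gt_0_contravar; nra.
      * replace (- 2 / V) with (- (2 / V)) by (field; lra).
        apply Ropp_lt_gt_0_contravar, Rdiv_lt_0_compat; lra.
      * apply Rdiv_lt_0_compat; nra.
    + fold V T; rewrite Hh, Hu; field; split; nra.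
    + fold V T; rewrite Hp, Hh.
      assert (HdW : is_derive (fun u => (sqrt_quad 4 49 u + 7 * u) / (sqrt_quad 4 49 u - u)) u
        (((49 * u / sqrt_quad 4 49 u + 7) * V
          - (sqrt_quad 4 49 u + 7 * u) * (49 * u / sqrt_quad 4 49 u - 1)) / V ^ 2)).
      { derive_quad 4 49 u Hd; [repeat split; trivial; fold V; lra|].
        unfold V in *; field; lra. }
      assert (HdT := is_derive_sqrt _ _ _ HdW HW); fold T in HdT.
      replace (8 / (T ^ 2 + 7) * - (T * (7 - 3 * T ^ 2) / 4) * (- 2 / V))
        with (/ 2 * ((((49 * u / sqrt_quad 4 49 u + 7) * V
          - (sqrt_quad 4 49 u + 7 * u) * (49 * u / sqrt_quad 4 49 u - 1)) / V ^ 2)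
          / (2 * T))).
      * apply (is_derive_ext (fun u => / 2 * (sqrt ((sqrt_quad 4 49 u + 7 * u) /
                 (sqrt_quad 4 49 u - u)) - 1))); [intros; apply Rmult_comm|].
        apply (is_derive_scal (fun u => sqrt ((sqrt_quad 4 49 u + 7 * u) /
                 (sqrt_quad 4 49 u - u)) - 1)).
        rewrite <- (Rminus_0_r (_ / (2 * T))).
        apply (is_derive_minus (fun u => sqrt ((sqrt_quad 4 49 u + 7 * u) /
                 (sqrt_quad 4 49 u - u))) (fun _ => 1));
          [exact HdT|apply (is_derive_const 1)].
      * rewrite HSV, Hu; field; repeat split; nra.
    + fold T V; rewrite Hh.
      derive_quad 4 49 u Hd; [repeat split; trivial; fold V; lra|].
      fold V; rewrite HSV, Hu; replace (V * (T ^ 2 + 7) / 8 + - _) with V by field.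
      field; split; nra.
Qed.

(** Since [(S + 3 u) (S - 3 u) = 16] and [S + 3 u = 4 / s^3], also [S - 3 u = 4 s^3]. Thus [u] and
    [S] are rational in [s]. *)
Lemma isochronous_system1 : is_isochronous_center P1 Q1 /\ is_urabe_function P1 Q1 h1.
Proof.
  pose (s u := exp (- (ln ((3 * u + sqrt_quad 16 9 u) / 4) / 3))).
  assert (H00 : sqrt_quad 16 9 0 = 4).
  { unfold sqrt_quad; replace (16 + 9 * 0 ^ 2) with (4 * 4) by ring.
    apply sqrt_square; lra. }
  assert (Hs0 : s 0 = 1).
  { unfold s; rewrite H00; replace ((3 * 0 + 4) / 4) with 1 by field.
    rewrite ln_1; replace (- (0 / 3)) with 0 by field; apply exp_0. }
  apply (isochronous_center_with_urabe_function P1 Q1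
    (fun x => - 1 + x - 1/2 * x^2 + 1/8 * x^3) (fun x => 1 - x + 3/8 * x^2)
    (fun x => x - 3/4 * x^2 + 5/24 * x^3 - 1/48 * x^4)
    (fun x => 1/4 + 3/8 * x - 1/16 * x^2) 3 16 9
    (fun u => 2 * (1 - s u ^ 2)) (fun u => - (s u ^ 3 / (1 - s u ^ 2 + s u ^ 4))) 1);
    try lra.
  - intros; nra.
  - reflexivity.
  - intros; unfold P1; field.
  - intros; unfold Q1; field.
  - poly_derivative.
  - rewrite Hs0; field.
  - rewrite Hs0; ring.
  - intros u _.
    assert (H : 0 < 16 + 9 * u ^ 2) by nra.
    assert (Hd := is_derive_sqrt_quad _ _ _ H).
    assert (HS := sqrt_quad_sqr _ _ _ H).
    assert (H1 := sqrt_quad_pos _ _ _ H).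
    assert (H2 : -3 * u < sqrt_quad 16 9 u) by (apply sqrt_quad_ge; lra).
    assert (Hex : ex_derive (sqrt_quad 16 9) u) by (eexists; exact Hd).
    assert (Hg : 0 < (3 * u + sqrt_quad 16 9 u) / 4) by lra.
    assert (Hs : 0 < s u) by apply exp_pos.
    assert (Hs3 : s u ^ 3 = / ((3 * u + sqrt_quad 16 9 u) / 4)).
    { rewrite <- (exp_ln _ Hg) at 1; rewrite <- exp_Ropp; unfold s; simpl.
      rewrite Rmult_1_r, <- !exp_plus; f_equal; field. }
    (* The logarithmic derivative of [3 u + S] is [3 / S], and [s] is a constant times its power of
       exponent [-1/3]. *)
    assert (Hds : is_derive s u (- (s u / sqrt_quad 16 9 u))).
    { unfold s at 1; derive_quad 16 9 u Hd; [repeat split; trivial; lra|].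
      change (exp _) with (s u); field; lra. }
    assert (Hes : ex_derive s u) by (eexists; exact Hds).
    clearbody s.
    set (w := s u) in *.
    assert (Hw3 : 0 < w ^ 3) by (apply pow_lt, Hs).
    assert (Hw : 3 * u + sqrt_quad 16 9 u = 4 / w ^ 3).
    { apply Rmult_eq_reg_r with (/ 4); [|lra].
      replace (4 / w ^ 3 * / 4) with (/ w ^ 3) by (field; lra).
      rewrite Hs3, Rinv_inv; reflexivity. }
    assert (Hw' : sqrt_quad 16 9 u - 3 * u = 4 * w ^ 3).
    { apply Rmult_eq_reg_l with (3 * u + sqrt_quad 16 9 u); [|lra].
      rewrite Hw at 2; field_simplify; [nra|lra]. }
    assert (HSw : sqrt_quad 16 9 u = 2 / w ^ 3 + 2 * w ^ 3).
    { replace (2 / w ^ 3) with (4 / w ^ 3 / 2) by (field; lra); lra. }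
    assert (Hu : u = (2 / w ^ 3 - 2 * w ^ 3) / 3).
    { replace (2 / w ^ 3) with (4 / w ^ 3 / 2) by (field; lra); lra. }
    assert (Hw2 : 0 < w ^ 2) by (apply pow_lt, Hs).
    assert (HD : 0 < 1 - w ^ 2 + w ^ 4) by nra.
    assert (HE : 0 < 1 + w ^ 6) by (assert (0 < w ^ 6) by (apply pow_lt, Hs); lra).
    assert (Hh : 1 + 3 * u / sqrt_quad 16 9 u = 2 / (1 + w ^ 6)).
    { rewrite HSw, Hu; field; lra. }
    (* The factor [1 - w^2 + w^4] cancels the denominator of [Y u], leaving
       [p1 (X u) * Y u = w^5]. *)
    assert (Hp : - 1 + 2 * (1 - w ^ 2) - 1/2 * (2 * (1 - w ^ 2)) ^ 2
                 + 1/8 * (2 * (1 - w ^ 2)) ^ 3 = - (w ^ 2 * (1 - w ^ 2 + w ^ 4)))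
      by field.
    split; [|split; [|split]].
    + fold w; rewrite Hp, Hh; split; [nra|split].
      * apply Ropp_lt_gt_0_contravar, Rdiv_lt_0_compat; lra.
      * apply Rdiv_lt_0_compat; lra.
    + fold w; rewrite Hh, Hu; field; lra.
    + fold w; rewrite Hp, Hh; auto_derive; [trivial|].
      replace (Derive (fun x => s x) u) with (- (w / sqrt_quad 16 9 u))
        by (symmetry; apply is_derive_unique, Hds).
      fold w; rewrite HSw; field; lra.
    + fold w; rewrite Hh; auto_derive; [repeat split; trivial; fold w; lra|].
      replace (Derive (fun x => s x) u) with (- (w / sqrt_quad 16 9 u))
        by (symmetry; apply is_derive_unique, Hds).
      fold w; rewrite HSw; field; lra.
Qed.

Theorem mainTheorem2 :
  (is_isochronous_center P1 Q1 /\ is_urabe_function P1 Q1 h1) /\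
  (is_isochronous_center P2 Q2 /\ is_urabe_function P2 Q2 h2) /\
  (forall a31 : R,
     is_isochronous_center (P3 a31) (Q3 a31) /\
     is_urabe_function (P3 a31) (Q3 a31) (h3 a31)) /\
  (is_isochronous_center P4 Q4 /\ is_urabe_function P4 Q4 h4).
Proof.
  exact (conj isochronous_system1 (conj isochronous_system2 (conj isochronous_system3 isochronous_system4))).
Qed.
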